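(* Assume that the following statement (Conjecture A) holds for all integers $n>1$ and all positive integers $a,b$ with $a+b=n+1$: for all division rings $F,G$, every ring embedding $\varphi:F\to M_n(G)$ and every $a\times b$ matrix $A$ with entries from $G$, there exist division ring extensions $G\subseteq G'$ and $F\subseteq F'$ and a ring embedding $\varphi':F'\to M_n(G')$ such that $\varphi'\restriction F=\varphi$ and $\operatorname{Im}(\varphi')$ contains a matrix whose upper right $a\times b$ block is $A$. Then, for any given integer $n>1$, each existentially closed model of the theory $T_n^1$ is a tight embedding $F\subseteq M_n(G)$.
   Context: Rings are associative and unital; ring embeddings are injective unital ring homomorphisms. For $G\subseteq G'$, $M_n(G)$ is regarded as a subring of $M_n(G')$. Tightness: let $\varphi:F\to M_n(G)$ be a ring embedding with $F,G$ division rings. For positive integers $a,b$ with $a+b=n+1$, $\varphi$ is called $a$-tight if for every $a\times b$ matrix $g$ with entries from $G$ there exists $f\in F$ such that the upper right $a\times b$ corner block of $\varphi(f)$ is $g$. The embedding $\varphi$ is called tight if it is $a$-tight for each $a\in\{1,2,\dots,n\}$. The theory $T_n^1$ ($n>1$ fixed) is the first-order theory in the language of unital rings extended by a unary relation symbol $F$ and constant symbols $e_{ij}$ ($i,j=1,\dots,n$) with the following axioms: (1) the axioms of rings; (2) $e_{ij}$ form a full set of matrix units: $\sum_{i=1}^n e_{ii}=1$, $e_{ij}e_{kl}=e_{il}$ if $j=k$, and $e_{ij}e_{kl}=0$ otherwise; (3) every nonzero element centralized by (i.e. commuting with) all $e_{ij}$ has an inverse which is also centralized by all $e_{ij}$;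 (4) $F$ defines a division subring; (5) the $1$-tightness axiom $(\forall x)(\exists y\in F)\; e_{11}(x-y)\left(\sum_{i=1}^n e_{ii}\right)=0$. Each model of $T_n^1$ has the form $M_n(G)$, where $G$ is the division ring of elements centralized by all $e_{ij}$ and the $e_{ij}$ are the matrix units, together with a specified division subring $F\subseteq M_n(G)$ such that the inclusion is $1$-tight; tightness is understood relative to these matrix units. A model $M$ of a theory $T$ is existentially closed if $M$ satisfies every existential sentence with parameters from $M$ that is satisfied in some extension $M'$ of $M$ (i.e. $M$ is a substructure of $M'$) which is also a model of $T$. *)

(* Defs.v *)
From mathcomp Require Import all_boot all_order all_algebra.

Set Implicit Arguments.
Unset Strict Implicit.
Unset Printing Implicit Defensive.

Import GRing.Theory.
Local Open Scope ring_scope.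

(* A unitRingType is nontrivial and not necessarily commutative. *)
Definition division_ring (R : unitRingType) : Prop :=
  forall x : R, x != 0 -> x \is a GRing.unit.

Section Tightness.

(* With a + b = n.+1 the columns n - b, ..., n.-1 are exactly the last b ones. *)
Definition has_upper_right_block (R : Type) (n a b : nat)
    (X : 'M[R]_n) (g : 'M[R]_(a, b)) : Prop :=
  forall (i : 'I_a) (j : 'I_b) (k l : 'I_n),
    k = i :> nat -> l = (n - b + j)%N :> nat -> X k l = g i j.

Definition a_tight (F G : unitRingType) (n : nat)
    (phi : {rmorphism F -> 'M[G]_n}) (a : nat) : Prop :=
  forall b : nat, (0 < b)%N -> (a + b = n.+1)%N ->
  forall g : 'M[G]_(a, b), exists f : F, has_upper_right_block (phi f) g.

Definition tight (F G : unitRingType) (n : nat)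
    (phi : {rmorphism F -> 'M[G]_n}) : Prop :=
  forall a : nat, (1 <= a <= n)%N -> a_tight phi a.

(* Ring extensions are given by injective morphisms rather than by inclusions. *)
Definition conjectureA (n a b : nat) : Prop :=
  forall (F G : unitRingType), division_ring F -> division_ring G ->
  forall (phi : {rmorphism F -> 'M[G]_n}), injective phi ->
  forall A : 'M[G]_(a, b),
  exists (F' G' : unitRingType)
         (iF : {rmorphism F -> F'}) (iG : {rmorphism G -> G'})
         (phi' : {rmorphism F' -> 'M[G']_n}),
    [/\ division_ring F' /\ division_ring G',
        injective iF /\ injective iG,
        injective phi',
        forall f : F, phi' (iF f) = map_mx iG (phi f)
      & exists f' : F', has_upper_right_block (phi' f') (map_mx iG A)].

End Tightness.

Section Language.

Variable n : nat.

(* V is the type of names that may occur free; a quantifier binds None in its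
   body. Hence formula void is the type of sentences, and formula M, for a
   structure M, that of sentences with parameters from M. *)
Inductive term (V : Type) : Type :=
| Var of V
| Zero
| One
| Add of term V & term V
| Opp of term V
| Mul of term V & term V
| MUnit of 'I_n & 'I_n.

Inductive formula (V : Type) : Type :=
| Eq of term V & term V
| InF of term V
| Tru
| Fls
| Not of formula V
| And of formula V & formula V
| Or of formula V & formula V
| Imp of formula V & formula V
| All of formula (option V)
| Ex of formula (option V).

Definition sentence := formula void.

Definition theory := sentence -> Prop.

Fixpoint quantifier_free (V : Type) (p : formula V) : Prop :=
  match p with
  | Eq _ _ | InF _ | Tru | Fls => True
  | Not q => quantifier_free q
  | And q r | Or q r | Imp q r => quantifier_free q /\ quantifier_free r
  | All _ | Ex _ => False
  end.

Fixpoint existential (V : Type) (p : formula V) : Prop :=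
  match p with
  | Ex q => existential q
  | _ => quantifier_free p
  end.

Record structure := Structure {
  carrier :> Type;
  s_zero : carrier;
  s_one : carrier;
  s_add : carrier -> carrier -> carrier;
  s_opp : carrier -> carrier;
  s_mul : carrier -> carrier -> carrier;
  s_F : carrier -> Prop;
  s_unit : 'I_n -> 'I_n -> carrier
}.

Fixpoint eval (M : structure) (V : Type) (v : V -> M) (t : term V) : M :=
  match t with
  | Var x => v x
  | Zero => s_zero M
  | One => s_one M
  | Add s u => s_add (eval v s) (eval v u)
  | Opp s => s_opp (eval v s)
  | Mul s u => s_mul (eval v s) (eval v u)
  | MUnit i j => s_unit M i j
  end.

Fixpoint sat (M : structure) (V : Type) (v : V -> M) (p : formula V) : Prop :=
  match p with
  | Eq s t => eval v s = eval v t
  | InF s => s_F (eval v s)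
  | Tru => True
  | Fls => False
  | Not q => ~ sat v q
  | And q r => sat v q /\ sat v r
  | Or q r => sat v q \/ sat v r
  | Imp q r => sat v q -> sat v r
  | All q => forall x : M, sat (fun o => oapp v x o) q
  | Ex q => exists x : M, sat (fun o => oapp v x o) q
  end.

Definition model (T : theory) (M : structure) : Prop :=
  forall p : sentence, T p -> sat (of_void M) p.

Record embedding (M N : structure) (f : M -> N) : Prop := Embedding {
  emb_inj : injective f;
  emb_zero : f (s_zero M) = s_zero N;
  emb_one : f (s_one M) = s_one N;
  emb_add : forall x y, f (s_add x y) = s_add (f x) (f y);
  emb_opp : forall x, f (s_opp x) = s_opp (f x);
  emb_mul : forall x y, f (s_mul x y) = s_mul (f x) (f y);
  emb_F : forall x, s_F (f x) <-> s_F x;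
  emb_unit : forall i j, f (s_unit M i j) = s_unit N i j
}.

Definition isomorphic (M N : structure) : Prop :=
  exists f : M -> N, embedding f /\ bijective f.

(* An extension of M is given by an embedding f, along which the parameters
   from M are interpreted. *)
Definition existentially_closed (T : theory) (M : structure) : Prop :=
  model T M /\
  forall (M' : structure) (f : M -> M'), embedding f -> model T M' ->
  forall p : formula M, existential p ->
    sat (M := M') f p -> sat (M := M) id p.

End Language.

Arguments Zero {n V}.
Arguments One {n V}.
Arguments MUnit {n V}.
Arguments Tru {n V}.
Arguments Fls {n V}.

Declare Scope folang_scope.
Delimit Scope folang_scope with fo.
Notation "0" := Zero : folang_scope.
Notation "1" := One : folang_scope.
Notation "s + t" := (Add s t) : folang_scope.
Notation "- t" := (Opp t) : folang_scope.
Notation "s - t" := (Add s (Opp t)) : folang_scope.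
Notation "s * t" := (Mul s t) : folang_scope.
Notation "s == t" := (Eq s t) : folang_scope.
Notation "s != t" := (Not (Eq s t)) : folang_scope.
Notation "p /\ q" := (And p q) : folang_scope.
Notation "p ==> q" := (Imp p q) : folang_scope.

Section TheoryT1.

Variable n : nat.

(* De Bruijn indices: x0 is bound by the innermost quantifier. *)
Local Notation x0 := (Var _ None).
Local Notation x1 := (Var _ (Some None)).
Local Notation x2 := (Var _ (Some (Some None))).

Local Open Scope folang_scope.

Definition sum_diag (V : Type) : term n V :=
  \big[@Add n V/0]_(i < n) MUnit i i.

Definition centralizes_units (V : Type) (t : term n V) : formula n V :=
  \big[@And n V/Tru]_(i < n) \big[@And n V/Tru]_(j < n)
    (t * MUnit i j == MUnit i j * t).

Inductive T1 : theory n :=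
| T1_addA : T1 (All (All (All (x2 + (x1 + x0) == (x2 + x1) + x0))))
| T1_addC : T1 (All (All (x1 + x0 == x0 + x1)))
| T1_add0 : T1 (All (0 + x0 == x0))
| T1_addN : T1 (All (- x0 + x0 == 0))
| T1_mulA : T1 (All (All (All (x2 * (x1 * x0) == (x2 * x1) * x0))))
| T1_mul1l : T1 (All (1 * x0 == x0))
| T1_mul1r : T1 (All (x0 * 1 == x0))
| T1_mulDl : T1 (All (All (All ((x2 + x1) * x0 == x2 * x0 + x1 * x0))))
| T1_mulDr : T1 (All (All (All (x2 * (x1 + x0) == x2 * x1 + x2 * x0))))
| T1_unit_sum : T1 (sum_diag void == 1)
| T1_unit_mul (i j k l : 'I_n) :
    T1 (MUnit i j * MUnit k l == if eq_op j k then MUnit i l else 0)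
| T1_centralizer : T1 (All ((x0 != 0 /\ centralizes_units x0) ==>
    Ex (centralizes_units x0 /\ (x1 * x0 == 1 /\ x0 * x1 == 1))))
| T1_F_1 : T1 (InF 1)
| T1_F_sub : T1 (All (All ((InF x1 /\ InF x0) ==> InF (x1 - x0))))
| T1_F_mul : T1 (All (All ((InF x1 /\ InF x0) ==> InF (x1 * x0))))
| T1_F_neq : T1 (1 != 0)
| T1_F_inv : T1 (All ((InF x0 /\ x0 != 0) ==>
    Ex (InF x0 /\ (x1 * x0 == 1 /\ x0 * x1 == 1))))
| T1_tight (i1 : 'I_n) of i1 = 0%N :> nat :
    T1 (All (Ex (InF x0 /\ MUnit i1 i1 * (x1 - x0) * sum_diag _ == 0))).

End TheoryT1.

Definition embedding_structure (F G : unitRingType) (n : nat)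
    (phi : {rmorphism F -> 'M[G]_n}) : structure n :=
  @Structure n 'M[G]_n 0 1 +%R -%R *%R
    (fun X => exists f : F, X = phi f) (fun i j => delta_mx i j).

(* An isomorphism of structures preserves the matrix units, so it carries the
   centralizer of the e_ij onto the scalar matrices, that is, onto G. *)
Definition is_tight_embedding (n : nat) (M : structure n) : Prop :=
  exists (F G : unitRingType) (phi : {rmorphism F -> 'M[G]_n}),
    [/\ division_ring F, division_ring G, injective phi,
        isomorphic M (embedding_structure phi) & tight phi].

(* Main.v *)
Require Import Defs.
From HB Require Import structures.
From mathcomp Require Import all_boot all_order all_algebra.
From mathcomp Require Import boolp classical_sets filter.

(* Drop 1-tightness from T1 and call the structures satisfying the rest
   premodels; they are exactly the embeddings F -> M_n(G). Conjecture A extends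
   a premodel so that a given upper right block is attained. Handling all first
   rows at once by an ultraproduct and iterating along an omega-chain, every
   premodel extends to a 1-tight one, that is, to a model of T1. So if M is a
   model and g a block, some model N above M attains g. Since M is 1-tight, F(N)
   meets M in F(M) only, hence N is an extension in the sense of the language,
   and "g is attained" is an existential sentence, which M then satisfies. *)

Set Implicit Arguments.
Unset Strict Implicit.
Unset Printing Implicit Defensive.

Import GRing.Theory.
Local Open Scope classical_set_scope.
Local Open Scope ring_scope.

(** * Division subrings as unit rings *)

Record division_subring (R : nzRingType) (P : R -> Prop) : Prop :=
  DivisionSubring {
    dsub1 : P 1;
    dsubB : forall x y, P x -> P y -> P (x - y);
    dsubM : forall x y, P x -> P y -> P (x * y);
    dsubV : forall x, P x -> x <> 0 ->
      exists y, [/\ P y, x * y = 1 & y * x = 1]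
  }.

Section DivisionSubringType.

Variables (R : nzRingType) (P : R -> Prop) (hP : division_subring P).

(* The proof argument lets the ring structure below be found by inference. *)
Definition dsub_pred of division_subring P : {pred R} := fun x => `[< P x >].

Lemma dsub_predP x : reflect (P x) (x \in dsub_pred hP).
Proof. exact: asboolP. Qed.

Lemma dsub_subring_closed : subring_closed (dsub_pred hP).
Proof.
split; first by apply/dsub_predP; apply: (dsub1 hP).
- by move=> x y /dsub_predP Px /dsub_predP Py; apply/dsub_predP/(dsubB hP).
- by move=> x y /dsub_predP Px /dsub_predP Py; apply/dsub_predP/(dsubM hP).
Qed.

HB.instance Definition _ :=
  GRing.isSubringClosed.Build R (dsub_pred hP) dsub_subring_closed.

Definition dsub := {x : R | dsub_pred hP x}.

HB.instance Definition _ := SubChoice.on dsub.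
HB.instance Definition _ := [SubChoice_isSubNzRing of dsub by <:].

Definition dsub_unit : pred dsub :=
  fun u => `[< exists v : dsub, v * u = 1 /\ u * v = 1 >].

(** The inverse is picked by choice; the default [u] off the units is what the unit ring interface
    demands in [dsub_inv_out]. *)
Definition dsub_inv (u : dsub) : dsub :=
  if pselect (exists v : dsub, v * u = 1 /\ u * v = 1) is left h
  then sval (cid h) else u.

Lemma dsub_mulVr : {in dsub_unit, left_inverse 1 dsub_inv *%R}.
Proof.
move=> u /asboolP hu; rewrite /dsub_inv.
by case: pselect => // h; case: cid => v [].
Qed.

Lemma dsub_mulrV : {in dsub_unit, right_inverse 1 dsub_inv *%R}.
Proof.
move=> u /asboolP hu; rewrite /dsub_inv.
by case: pselect => // h; case: cid => v [].
Qed.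

Lemma dsub_unitP (u v : dsub) : v * u = 1 /\ u * v = 1 -> dsub_unit u.
Proof. by move=> huv; apply/asboolP; exists v. Qed.

Lemma dsub_inv_out : {in [predC dsub_unit], dsub_inv =1 id}.
Proof.
move=> u /negP hu; rewrite /dsub_inv; case: pselect => // h.
by case: hu; apply/asboolP.
Qed.

HB.instance Definition _ := GRing.NzRing_hasMulInverse.Build dsub
  dsub_mulVr dsub_mulrV dsub_unitP dsub_inv_out.

Definition dsub_of x (Px : P x) : dsub := Sub x (introT (dsub_predP x) Px).

Lemma dsub_ofK x (Px : P x) : \val (dsub_of Px) = x.
Proof. exact: SubK. Qed.

Lemma dsub_ex x : P x -> exists u : dsub, \val u = x.
Proof. by move=> Px; exists (dsub_of Px); apply: dsub_ofK. Qed.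

Lemma dsub_valP (u : dsub) : P (\val u).
Proof. exact/dsub_predP/(valP u). Qed.

Lemma dsub_division : division_ring dsub.
Proof.
move=> u u0; have /(dsubV hP (dsub_valP u)) [y [Py uy yu]] : \val u <> 0.
  by move/eqP: u0 => u0 u0'; apply: u0; apply: val_inj; rewrite u0' rmorph0.
have [v vy] := dsub_ex Py; apply/asboolP; exists v.
by split; apply: val_inj; rewrite rmorphM rmorph1 /= vy.
Qed.

End DivisionSubringType.

(* The theory T1 without the tightness axiom, read off in a structure. *)
Record premodel (n : nat) (S : structure n) : Prop := Premodel {
  pm_addA : associative (@s_add n S);
  pm_addC : commutative (@s_add n S);
  pm_add0 : left_id (s_zero S) (@s_add n S);
  pm_addN : left_inverse (s_zero S) (@s_opp n S) (@s_add n S);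
  pm_mulA : associative (@s_mul n S);
  pm_mul1l : left_id (s_one S) (@s_mul n S);
  pm_mul1r : right_id (s_one S) (@s_mul n S);
  pm_mulDl : left_distributive (@s_mul n S) (@s_add n S);
  pm_mulDr : right_distributive (@s_mul n S) (@s_add n S);
  pm_unit_sum : \big[@s_add n S/s_zero S]_(i < n) s_unit S i i = s_one S;
  pm_unit_mul : forall i j k l,
    s_mul (s_unit S i j) (s_unit S k l) =
    if j == k then s_unit S i l else s_zero S;
  pm_centralizer : forall x : S, x <> s_zero S ->
    (forall i j, s_mul x (s_unit S i j) = s_mul (s_unit S i j) x) ->
    exists y : S,
      [/\ forall i j, s_mul y (s_unit S i j) = s_mul (s_unit S i j) y,
          s_mul x y = s_one S & s_mul y x = s_one S];
  pm_F1 : s_F (s_one S);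
  pm_FB : forall x y : S, s_F x -> s_F y -> s_F (s_add x (s_opp y));
  pm_FM : forall x y : S, s_F x -> s_F y -> s_F (s_mul x y);
  pm_neq : s_one S <> s_zero S;
  pm_FV : forall x : S, s_F x -> x <> s_zero S ->
    exists y : S, [/\ s_F y, s_mul x y = s_one S & s_mul y x = s_one S]
}.

(** * A premodel as a matrix ring over the centralizer of its units *)

Section PremodelRing.

Variables (n : nat) (S : structure n) (hS : premodel S).

Definition ring_of of premodel S : Type := S.

Local Notation R := (ring_of hS).

HB.instance Definition _ := gen_eqMixin R.
HB.instance Definition _ := gen_choiceMixin R.

Lemma ring_of_neq : (s_one S : R) != s_zero S.
Proof. exact/eqP/(pm_neq hS). Qed.

HB.instance Definition _ := GRing.isNzRing.Build R
  (pm_addA hS) (pm_addC hS) (pm_add0 hS) (pm_addN hS) (pm_mulA hS)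
  (pm_mul1l hS) (pm_mul1r hS) (pm_mulDl hS) (pm_mulDr hS) ring_of_neq.

Local Notation e i j := (s_unit S i j : R).

Lemma sum_unit : \sum_(i < n) e i i = 1.
Proof. exact: (pm_unit_sum hS). Qed.

Lemma mul_unit i j k l : e i j * e k l = if j == k then e i l else 0.
Proof. exact: (pm_unit_mul hS). Qed.

Definition central (x : R) : Prop := forall i j, x * e i j = e i j * x.

Lemma central_division_subring : division_subring central.
Proof.
split.
- by move=> i j; rewrite mul1r mulr1.
- by move=> x y Cx Cy i j; rewrite mulrBl mulrBr Cx Cy.
- by move=> x y Cx Cy i j; rewrite -mulrA Cy mulrA Cx mulrA.
- by move=> x Cx x0; apply: (pm_centralizer hS).
Qed.

Lemma F_division_subring : division_subring (@s_F n S : R -> Prop).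
Proof. by split; [apply: pm_F1|apply: pm_FB|apply: pm_FM|apply: pm_FV]. Qed.

Local Notation G := (dsub central_division_subring).
Local Notation F := (dsub F_division_subring).

(** The (k, l) entry of x as a scalar matrix: [e i k * x * e l i] moves that entry to the place (i,
    i), and the sum repeats it along the diagonal. *)
Definition coef (k l : 'I_n) (x : R) : R := \sum_i e i k * x * e l i.

Lemma coef_mul_unit k l x a b : coef k l x * e a b = e a k * x * e l b.
Proof.
rewrite mulr_suml (bigD1 a) //= big1 ?addr0 -?mulrA ?mul_unit ?eqxx // => i ia.
by rewrite -!mulrA mul_unit (negPf ia) !mulr0.
Qed.

Lemma unit_mul_coef k l x a b : e a b * coef k l x = e a k * x * e l b.
Proof.
rewrite mulr_sumr (bigD1 b) //= big1 ?addr0 ?mulrA ?mul_unit ?eqxx // => i ib.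
by rewrite !mulrA mul_unit eq_sym (negPf ib) !mul0r.
Qed.

Lemma coef_central k l x : central (coef k l x).
Proof. by move=> a b; rewrite coef_mul_unit unit_mul_coef. Qed.

Lemma coefB k l x y : coef k l (x - y) = coef k l x - coef k l y.
Proof.
by rewrite /coef -sumrB; apply: eq_bigr => i _; rewrite mulrBr mulrBl.
Qed.

Lemma coef1 k l : coef k l 1 = (k == l)%:R.
Proof.
rewrite /coef; case: (eqVneq k l) => [->|kl].
  rewrite -[RHS]sum_unit; apply: eq_bigr => i _.
  by rewrite mulr1 mul_unit eqxx.
by apply: big1 => i _; rewrite mulr1 mul_unit (negPf kl).
Qed.

(** Inserting 1 = sum_m e_mm between x and y yields the matrix product of the entries. *)
Lemma coefM k l x y : coef k l (x * y) = \sum_m coef k m x * coef m l y.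
Proof.
have -> : \sum_m coef k m x * coef m l y =
          \sum_m \sum_i e i k * x * e m m * y * e l i.
  apply: eq_bigr => m _; rewrite mulr_suml; apply: eq_bigr => i _.
  by rewrite -!mulrA unit_mul_coef -!mulrA.
rewrite exchange_big; apply: eq_bigr => i _ /=.
rewrite -mulr_suml -mulr_suml -mulr_sumr sum_unit mulr1.
by rewrite !mulrA.
Qed.

Lemma coef_unit k l a b : coef k l (e a b) = ((k == a) && (l == b))%:R.
Proof.
rewrite /coef; under eq_bigr => i _ do rewrite mul_unit.
case: (eqVneq k a) => /= _; last by apply: big1 => i _; rewrite mul0r.
under eq_bigr => i _ do rewrite mul_unit eq_sym.
by case: (eqVneq l b) => /= _; [apply: sum_unit|apply: big1].
Qed.

(** Expand both factors 1 of x = 1 x 1 as sums of the e_kk. *)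
Lemma coef_sum x : x = \sum_k \sum_l coef k l x * e k l.
Proof.
transitivity (\sum_k \sum_l e k k * x * e l l).
  under eq_bigr => k _ do rewrite -mulr_sumr sum_unit mulr1.
  by rewrite -mulr_suml sum_unit mul1r.
by apply: eq_bigr => k _; apply: eq_bigr => l _; rewrite coef_mul_unit.
Qed.

Definition matrix_of (x : R) : 'M[G]_n :=
  \matrix_(k, l) dsub_of central_division_subring (coef_central k l x).

Lemma matrix_ofE x k l : \val (matrix_of x k l) = coef k l x.
Proof. by rewrite mxE dsub_ofK. Qed.

Lemma matrix_ofB x y : matrix_of (x - y) = matrix_of x - matrix_of y.
Proof.
apply/matrixP => k l; apply: val_inj; rewrite matrix_ofE coefB -!matrix_ofE.
by rewrite -rmorphB; congr (\val _); rewrite [RHS]mxE [X in _ = _ + X]mxE.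
Qed.

Lemma matrix_of1 : matrix_of 1 = 1%:M.
Proof.
apply/matrixP => k l; apply: val_inj; rewrite matrix_ofE coef1 mxE.
by rewrite rmorph_nat.
Qed.

Lemma matrix_ofM x y : matrix_of (x * y) = matrix_of x *m matrix_of y.
Proof.
apply/matrixP => k l; apply: val_inj; rewrite matrix_ofE coefM mxE rmorph_sum.
by apply: eq_bigr => m _; rewrite rmorphM /= !matrix_ofE.
Qed.

Lemma matrix_of_unit a b : matrix_of (e a b) = delta_mx a b.
Proof.
apply/matrixP => k l; apply: val_inj; rewrite matrix_ofE coef_unit mxE.
by rewrite rmorph_nat.
Qed.

Lemma matrix_of_inj : injective matrix_of.
Proof.
move=> x y xy; rewrite [x]coef_sum [y]coef_sum.
by apply: eq_bigr => k _; apply: eq_bigr => l _; rewrite -!matrix_ofE xy.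
Qed.

Definition of_matrix (A : 'M[G]_n) : R := \sum_k \sum_l \val (A k l) * e k l.

Lemma of_matrixK : cancel of_matrix matrix_of.
Proof.
move=> A; apply/matrixP => a b; apply: val_inj; rewrite matrix_ofE.
rewrite /coef; under eq_bigr => i _.
  (* Only the summand (a, b) of [of_matrix A] survives; its coefficient is central, so it moves past
     [e i a]. *)
  have -> : e i a * of_matrix A * e b i = \val (A a b) * e i i.
    rewrite /of_matrix mulr_sumr mulr_suml (bigD1 a) //= [X in _ + X]big1.
      rewrite addr0 mulr_sumr mulr_suml (bigD1 b) //= [X in _ + X]big1.
        rewrite addr0 mulrA -(dsub_valP (A a b)) -!mulrA mul_unit eqxx.
        by rewrite mul_unit eqxx.
      move=> l lb; rewrite -!mulrA mul_unit (negPf lb).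
      by rewrite !mulr0.
    move=> k ka; rewrite mulr_sumr mulr_suml big1 // => l _.
    rewrite !mulrA -(dsub_valP (A k l)) -(mulrA _ (e i a)) mul_unit.
    by rewrite eq_sym (negPf ka) mulr0 mul0r.
  over.
by rewrite -mulr_sumr sum_unit mulr1.
Qed.

Lemma matrix_of_bij : bijective matrix_of.
Proof.
exists of_matrix; last exact: of_matrixK.
by move=> x; apply: matrix_of_inj; rewrite of_matrixK.
Qed.

Definition matrix_of_F (f : F) : 'M[G]_n := matrix_of (\val f).

Lemma matrix_of_F_zmod : zmod_morphism matrix_of_F.
Proof. by move=> f g; rewrite /matrix_of_F rmorphB matrix_ofB. Qed.

Lemma matrix_of_F_monoid : monoid_morphism matrix_of_F.
Proof.
split=> [|f g]; rewrite /matrix_of_F; first by rewrite rmorph1 matrix_of1.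
by rewrite rmorphM matrix_ofM.
Qed.

HB.instance Definition _ :=
  GRing.isZmodMorphism.Build F 'M[G]_n matrix_of_F matrix_of_F_zmod.
HB.instance Definition _ :=
  GRing.isMonoidMorphism.Build F 'M[G]_n matrix_of_F matrix_of_F_monoid.

Lemma premodel_isomorphic :
  exists (F G : unitRingType) (phi : {rmorphism F -> 'M[G]_n}),
    [/\ division_ring F, division_ring G, injective phi
      & isomorphic S (embedding_structure phi)].
Proof.
exists F, G, matrix_of_F; split.
- exact: dsub_division.
- exact: dsub_division.
- by move=> f g /matrix_of_inj; apply: val_inj.
exists matrix_of; split; last exact: matrix_of_bij.
have m0 : matrix_of 0 = 0 by rewrite -(subr0 0) matrix_ofB subrr.
have mN x : matrix_of (- x) = - matrix_of x by rewrite -sub0r matrix_ofB m0 sub0r.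
have mD (x y : R) : matrix_of (x + y) = matrix_of x + matrix_of y.
  by rewrite -[y in LHS]opprK matrix_ofB mN opprK.
split=> //=.
- exact: matrix_of_inj.
- exact: matrix_of1.
- move=> x y; exact: (matrix_ofM x y).
- move=> x; split=> [[f /matrix_of_inj ->]|Fx]; first exact: dsub_valP.
  by have [f fx] := dsub_ex F_division_subring Fx; exists f;
    rewrite /= /matrix_of_F fx.
- exact: matrix_of_unit.
Qed.

End PremodelRing.

(** * First rows and the models of the theory *)

(** The equation says that x and y have the same first row. Quantifying over the i of value 0 avoids
    assuming n > 0. *)
Definition F_meets_first_row (n : nat) (S : structure n) (x : S) : Prop :=
  forall i : 'I_n, i = 0%N :> nat -> exists y : S,
    s_F y /\ s_mul (s_unit S i i) (s_add x (s_opp y)) = s_zero S.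

Definition one_tight (n : nat) (S : structure n) : Prop :=
  forall x : S, F_meets_first_row x.

Lemma eval_sum_diag (n : nat) (S : structure n) (V : Type) (v : V -> S) :
  eval v (sum_diag n V) = \big[@s_add n S/s_zero S]_(i < n) s_unit S i i.
Proof. exact: (big_morph (eval v)). Qed.

Lemma sat_big_And (n : nat) (S : structure n) (V : Type) (v : V -> S)
    (I : finType) (P : pred I) (p : I -> formula n V) :
  sat v (\big[@And n V/Tru]_(i | P i) p i) <-> forall i, P i -> sat v (p i).
Proof.
(* Membership in the enumeration is made explicit so that induction on the list applies. *)
transitivity (forall i, i \in index_enum I -> P i -> sat v (p i)); last first.
  by split=> h i; [apply: h; apply: mem_index_enum|move=> _; apply: h].
elim: (index_enum I) => [|i r IHr]; first by rewrite big_nil.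
rewrite big_cons; case: ifPn => Pi /=.
  split=> [[hi /IHr hr] j|h].
    by rewrite inE => /orP[/eqP-> //|]; apply: hr.
  split; first by apply: h => //; apply: mem_head.
  by apply/IHr => j jr; apply: h; rewrite inE jr orbT.
split=> [/IHr hr j|h].
  by rewrite inE => /orP[/eqP->|]; [rewrite (negPf Pi)|apply: hr].
by apply/IHr => j jr; apply: h; rewrite inE jr orbT.
Qed.

Lemma quantifier_free_big_And (n : nat) (V : Type)
    (I : finType) (P : pred I) (p : I -> formula n V) :
  (forall i, quantifier_free (p i)) ->
  quantifier_free (\big[@And n V/Tru]_(i | P i) p i).
Proof. by move=> h; elim/big_rec: _. Qed.

Lemma sat_centralizes_units (n : nat) (S : structure n) (V : Type)
    (v : V -> S) (t : term n V) :
  sat v (centralizes_units t) <->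
  forall i j, s_mul (eval v t) (s_unit S i j) = s_mul (s_unit S i j) (eval v t).
Proof.
split=> [/sat_big_And h i j|h].
  by have /sat_big_And := h i isT; apply.
by apply/sat_big_And => i _; apply/sat_big_And => j _; apply: h.
Qed.

Lemma model_T1P (n : nat) (S : structure n) :
  model (@T1 n) S <-> premodel S /\ one_tight S.
Proof.
split=> [h|[hS tS] p].
  have hsum : \big[@s_add n S/s_zero S]_(i < n) s_unit S i i = s_one S.
    by have := h _ (T1_unit_sum n); rewrite /= eval_sum_diag.
  split; first split=> //.
  - exact: h _ (T1_addA n).
  - exact: h _ (T1_addC n).
  - exact: h _ (T1_add0 n).
  - exact: h _ (T1_addN n).
  - exact: h _ (T1_mulA n).
  - exact: h _ (T1_mul1l n).
  - exact: h _ (T1_mul1r n).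
  - by move=> x y z; apply: (h _ (T1_mulDl n) x y z).
  - by move=> x y z; apply: (h _ (T1_mulDr n) x y z).
  - by move=> i j k l; have := h _ (T1_unit_mul i j k l) => /=; case: ifP.
  - move=> x x0 xc; have /= := h _ (T1_centralizer n) x.
    case; first by split=> //; apply/sat_centralizes_units.
    by move=> y [/sat_centralizes_units yc [xy yx]]; exists y.
  - exact: h _ (T1_F_1 n).
  - by move=> x y Fx Fy; apply: (h _ (T1_F_sub n) x y).
  - by move=> x y Fx Fy; apply: (h _ (T1_F_mul n) x y).
  - exact: h _ (T1_F_neq n).
  - move=> x Fx x0; have /= [//|y [Fy [xy yx]]] := h _ (T1_F_inv n) x.
    by exists y.
  (* The right factor sum_i e_ii in the tightness axiom is 1, so the axiom is the first-row
     condition. *)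
  move=> x i i0; have /= [y [Fy]] := h _ (T1_tight i0) x.
  rewrite eval_sum_diag hsum => xy; exists y; split=> //.
  by rewrite -[LHS](h _ (T1_mul1r n)).
case=> /=.
- exact: pm_addA hS.
- exact: pm_addC hS.
- exact: pm_add0 hS.
- exact: pm_addN hS.
- exact: pm_mulA hS.
- exact: pm_mul1l hS.
- exact: pm_mul1r hS.
- by move=> x y z; apply: (pm_mulDl hS).
- by move=> x y z; apply: (pm_mulDr hS).
- by rewrite eval_sum_diag (pm_unit_sum hS).
- by move=> i j k l; rewrite (pm_unit_mul hS); case: ifP.
- move=> x [x0 /sat_centralizes_units xc].
  have [y [yc xy yx]] := pm_centralizer hS x0 xc.
  by exists y; split; first exact/sat_centralizes_units.
- exact: pm_F1 hS.
- by move=> x y [Fx Fy]; apply: (pm_FB hS).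
- by move=> x y [Fx Fy]; apply: (pm_FM hS).
- exact: pm_neq hS.
- move=> x [Fx x0]; have [y [Fy xy yx]] := pm_FV hS Fx x0.
  by exists y.
- move=> i i0 x; have [y [Fy xy]] := tS x i i0; exists y; split=> //.
  by rewrite eval_sum_diag (pm_unit_sum hS) (pm_mul1r hS).
Qed.

(** * Matrix units, and embeddings as premodels *)

(** Both [delta_mx k k] and [delta_mx l l] factor through dimension 1, which leaves the single entry
    [A k l] in the middle. *)
Lemma delta_mx_corner (R : pzRingType) (n : nat) (A : 'M[R]_n) (k l : 'I_n) :
  delta_mx k k *m A *m delta_mx l l =
  delta_mx k (0 : 'I_1) *m (A k l)%:M *m delta_mx 0 l.
Proof.
rewrite -(mul_delta_mx (0 : 'I_1) k k) -(mul_delta_mx (0 : 'I_1) l l).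
rewrite !mulmxA; congr (_ *m _); rewrite -!mulmxA; congr (_ *m _).
rewrite mulmxA; apply/matrixP => i j; rewrite !ord1 -rowE -colE !mxE.
by rewrite mulr1n.
Qed.

(** This makes equality of entries expressible by ring operations and matrix units, hence in the
    first-order language. *)
Lemma delta_mx_corner_eq (R : pzRingType) (n : nat) (A B : 'M[R]_n) (k l : 'I_n) :
  delta_mx k k *m A *m delta_mx l l = delta_mx k k *m B *m delta_mx l l <->
  A k l = B k l.
Proof.
split=> [h|AB]; last by rewrite !delta_mx_corner AB.
have corner (C : 'M[R]_n) : (delta_mx k k *m C *m delta_mx l l) k l = C k l.
  rewrite mxE (bigD1 l) //= big1 => [|i /negPf il].
    rewrite !mxE !eqxx mulr1 addr0 (bigD1 k) //= big1 => [|i /negPf ik].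
      by rewrite !mxE !eqxx mul1r addr0.
    by rewrite !mxE ik andbF mul0r.
  by rewrite [X in _ * X]mxE il mulr0.
by rewrite -corner h corner.
Qed.

(** Comparing the entries (i, 0) of A e_k0 = e_k0 A shows that [A i k] is [A 0 0] if i = k and 0
    otherwise. *)
Lemma comm_delta_mx_scalar (R : pzRingType) (n : nat) (A : 'M[R]_n.+1) :
  (forall i j, A *m delta_mx i j = delta_mx i j *m A) -> A = (A 0 0)%:M.
Proof.
move=> h; apply/matrixP => i k; have /matrixP/(_ i 0) := h k 0.
rewrite !mxE (bigD1 k) //= big1 ?addr0 => [|j /negPf jk]; last first.
  by rewrite mxE jk mulr0.
rewrite (bigD1 0) //= big1 ?addr0 => [|j /negPf j0]; last first.
  by rewrite mxE j0 andbF mul0r.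
rewrite !mxE !eqxx mulr1 andbT => ->.
by case: eqP; rewrite ?mul1r ?mul0r.
Qed.

Lemma scalar_comm_delta_mx (R : pzRingType) (n : nat) (c : R) (i j : 'I_n) :
  c%:M *m delta_mx i j = delta_mx i j *m c%:M.
Proof.
rewrite mul_scalar_mx; apply/matrixP => k l; rewrite !mxE.
rewrite (bigD1 j) //= big1 ?addr0 => [|m /negPf mj]; last first.
  by rewrite mxE mj andbF mul0r.
rewrite !mxE eqxx andbT; case: (k == i); case: eqVneq => _;
by rewrite ?eqxx ?mulr1 ?mul1r ?mulr0 ?mul0r.
Qed.

Lemma embedding_structure_premodel (n : nat) (F G : unitRingType)
    (phi : {rmorphism F -> 'M[G]_n}) :
  (0 < n)%N -> division_ring F -> division_ring G -> injective phi ->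
  premodel (embedding_structure phi).
Proof.
(* For n = 0 the matrix ring is trivial and [pm_neq] would fail. *)
case: n phi => // n phi _ dF dG phi_inj.
have neq10 : (1 : 'M[G]_n.+1) <> 0 by apply/eqP/oner_neq0.
split=> //=.
- exact: addrA.
- exact: addrC.
- exact: add0r.
- exact: addNr.
- exact: mulrA.
- exact: mul1r.
- exact: mulr1.
- exact: mulrDl.
- exact: mulrDr.
- rewrite -[RHS]/(1%:M : 'M_n.+1) -diag_const_mx.
  by rewrite diag_mx_sum_delta; apply: eq_bigr => i _; rewrite mxE scale1r.
- move=> i j k l; rewrite -[LHS]/(delta_mx i j *m delta_mx k l).
  by rewrite mul_delta_mx_cond; case: eqP.
- move=> A A0 /comm_delta_mx_scalar; set c := A 0 0 => hA.
  have cU : c \is a GRing.unit.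
    by apply: dG; apply: contra_notN A0 => /eqP c0; rewrite hA c0 raddf0.
  exists c^-1%:M; split.
  + by move=> i j; apply: scalar_comm_delta_mx.
  + by rewrite hA -[LHS]scalar_mxM divrr.
  + by rewrite hA -[LHS]scalar_mxM mulVr.
- by exists 1; rewrite rmorph1.
- by move=> _ _ [f ->] [g ->]; exists (f - g); rewrite rmorphB.
- by move=> _ _ [f ->] [g ->]; exists (f * g); rewrite rmorphM.
- move=> _ [f ->] f0.
  have fU : f \is a GRing.unit.
    by apply: dF; apply: contra_notN f0 => /eqP ->; rewrite rmorph0.
  exists (phi f^-1); split; first by exists f^-1.
  + by rewrite -rmorphM divrr ?rmorph1.
  + by rewrite -rmorphM mulVr ?rmorph1.
Qed.

(** * Weak embeddings and Conjecture A for premodels *)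

(** F is preserved but perhaps not reflected: Conjecture A allows old matrices to enter the image of
    the larger division ring. Reflection is recovered in [one_tight_embedding]. *)
Record weak_embedding (n : nat) (M N : structure n) (f : M -> N) : Prop :=
  WeakEmbedding {
  wemb_inj : injective f;
  wemb0 : f (s_zero M) = s_zero N;
  wemb1 : f (s_one M) = s_one N;
  wembD : forall x y, f (s_add x y) = s_add (f x) (f y);
  wembN : forall x, f (s_opp x) = s_opp (f x);
  wembM : forall x y, f (s_mul x y) = s_mul (f x) (f y);
  wembF : forall x, s_F x -> s_F (f x);
  wemb_unit : forall i j, f (s_unit M i j) = s_unit N i j
}.

Lemma wemb_id (n : nat) (M : structure n) : weak_embedding (@id M).
Proof. by split. Qed.

Lemma wemb_comp (n : nat) (M N K : structure n) (f : M -> N) (g : N -> K) :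
  weak_embedding f -> weak_embedding g -> weak_embedding (g \o f).
Proof.
move=> hf hg; split=> [|||x y|x|x y|x Fx|i j] /=.
- exact: inj_comp (wemb_inj hg) (wemb_inj hf).
- by rewrite (wemb0 hf) (wemb0 hg).
- by rewrite (wemb1 hf) (wemb1 hg).
- by rewrite (wembD hf) (wembD hg).
- by rewrite (wembN hf) (wembN hg).
- by rewrite (wembM hf) (wembM hg).
- exact/(wembF hg)/(wembF hf).
- by rewrite (wemb_unit hf) (wemb_unit hg).
Qed.

Lemma F_meets_first_row_wemb (n : nat) (M N : structure n) (f : M -> N) (x : M) :
  weak_embedding f -> F_meets_first_row x -> F_meets_first_row (f x).
Proof.
move=> hf hx i i0; have [y [Fy xy]] := hx i i0.
exists (f y); split; first exact: wembF hf _ Fy.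
by rewrite -(wemb_unit hf) -(wembN hf) -(wembD hf) -(wembM hf) xy (wemb0 hf).
Qed.

Lemma map_mx_wemb (n : nat) (F G F' G' : unitRingType)
    (phi : {rmorphism F -> 'M[G]_n}) (phi' : {rmorphism F' -> 'M[G']_n})
    (iF : {rmorphism F -> F'}) (iG : {rmorphism G -> G'}) :
  injective iG -> (forall f, phi' (iF f) = map_mx iG (phi f)) ->
  @weak_embedding n (embedding_structure phi) (embedding_structure phi') (map_mx iG).
Proof.
move=> iG_inj hphi; split=> /=.
- move=> A B /matrixP AB; apply/matrixP => k l; apply: iG_inj.
  by have := AB k l; rewrite !mxE.
- exact: map_mx0.
- exact: map_mx1.
- by move=> A B; apply: map_mxD.
- by move=> A; apply: map_mxN.
- by move=> A B; apply: map_mxM.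
- by move=> _ [f ->]; exists (iF f); rewrite hphi.
- exact: map_delta_mx.
Qed.

Lemma embedding_wemb (n : nat) (M N : structure n) (f : M -> N) :
  embedding f -> weak_embedding f.
Proof. by case=> *; split=> // x Fx; apply/emb_F. Qed.

(* The corner (k, l) of an element x is read off from e_kk x e_ll. *)
Definition same_upper_right_block (n a b : nat) (S : structure n) (x y : S) :=
  forall k l : 'I_n, (k < a)%N -> (n - b <= l)%N ->
  s_mul (s_mul (s_unit S k k) x) (s_unit S l l) =
  s_mul (s_mul (s_unit S k k) y) (s_unit S l l).

(** The isomorphism with an embedding into M_n(G) turns x into a matrix, and Conjecture A is applied
    to the upper right block of that matrix. *)
Lemma conjectureA_premodel (n a b : nat) (S : structure n) (x : S) :
  conjectureA n a b -> (a + b = n.+1)%N -> (0 < a)%N -> (0 < b)%N ->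
  premodel S ->
  exists (S' : structure n) (f : S -> S'), [/\ premodel S', weak_embedding f &
    exists y, s_F y /\ same_upper_right_block a b y (f x)].
Proof.
move=> hA hab a0 b0 hS.
have n0 : (0 < n)%N by rewrite -ltnS -hab; case: a b a0 b0 {hA hab} => [|[|a]] [].
have [F [G [phi [dF dG phi_inj [h [hh h_bij]]]]]] := premodel_isomorphic hS.
(* As a and b are positive with a + b = n + 1, both are at most n, so block indices give rows and
   columns of the matrix. *)
have ha (i : 'I_a) : (i < n)%N.
  by rewrite -ltnS -hab; apply: leq_ltn_trans (ltn_ord i) _;
    rewrite -addn1 leq_add2l.
have hb (j : 'I_b) : (n - b + j < n)%N.
  have bn : (b <= n)%N by rewrite -ltnS -hab -add1n leq_add2r.
  by rewrite -[X in (_ < X)%N](subnK bn) ltn_add2l.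
pose A := \matrix_(i < a, j < b) (h x : 'M[G]_n) (Ordinal (ha i)) (Ordinal (hb j)).
have [F' [G' [iF [iG [phi' [[dF' dG'] [iF_inj iG_inj] phi'_inj hphi [y hy]]]]]]] :=
  hA F G dF dG phi phi_inj A.
exists (embedding_structure phi'), (map_mx iG \o h); split.
- exact: embedding_structure_premodel.
- exact: wemb_comp (embedding_wemb hh) (map_mx_wemb iG_inj hphi).
exists (phi' y); split; first by exists y.
move=> k l ka bl; apply/delta_mx_corner_eq.
have lb : (l - (n - b) < b)%N.
  by rewrite ltn_subLR // subnK // -ltnS -hab -add1n leq_add2r.
rewrite (hy (Ordinal ka) (Ordinal lb)) /= ?subnKC // !mxE /=.
by congr (iG (h x _ _)); apply: val_inj; rewrite /= ?subnKC.
Qed.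

(** * Reduced products of premodels *)

(** Classes are encoded as the predicates [E x], equal by extensionality for related elements;
    representatives come from choice. *)
Lemma quotient_exists (Q : Type) (E : Q -> Q -> Prop) :
  (forall x, E x x) -> (forall x y, E x y -> E y x) ->
  (forall x y z, E x y -> E y z -> E x z) ->
  exists (T : Type) (pi : Q -> T) (repr : T -> Q),
    cancel repr pi /\ forall x y, pi x = pi y <-> E x y.
Proof.
move=> Erefl Esym Etrans.
pose T := {A : Q -> Prop | exists x, A = E x}.
pose pi x : T := exist _ (E x) (ex_intro _ x erefl).
have piE x y : pi x = pi y <-> E x y.
  split=> [/(congr1 sval)/= ->|Exy]; first exact: Erefl.
  apply: eq_exist => /=; apply/funext => z; apply/propext.
  by split; [apply/Etrans/Esym|apply/Etrans].
have /choice [repr reprK] (t : T) : exists x, pi x = t.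
  by case: t => A [x Ax]; exists x; apply: eq_exist; rewrite /= Ax.
by exists T, pi, repr.
Qed.

Section ReducedProduct.

Variables (n : nat) (I : Type) (S : I -> structure n).

(* A family P of sections closed under the operations; the last two fields
   make the reduced product a premodel although the filter need not be an
   ultrafilter. *)
Record admissible (U : set_system I) (P : (forall i, S i) -> Prop) : Prop :=
  Admissible {
    adm0 : P (fun i => s_zero (S i));
    adm1 : P (fun i => s_one (S i));
    admD : forall x y, P x -> P y -> P (fun i => s_add (x i) (y i));
    admN : forall x, P x -> P (fun i => s_opp (x i));
    admM : forall x y, P x -> P y -> P (fun i => s_mul (x i) (y i));
    adm_unit : forall k l, P (fun i => s_unit (S i) k l);
    admV : forall x y : forall i, S i, P x ->
      U [set i | s_mul (x i) (y i) = s_one (S i) /\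
                 s_mul (y i) (x i) = s_one (S i)] -> P y;
    adm_dec : forall x : forall i, S i, P x ->
      U [set i | x i = s_zero (S i)] \/ U [set i | x i <> s_zero (S i)]
  }.

Variables (U : set_system I) (P : (forall i, S i) -> Prop).
Hypotheses (FU : ProperFilter U) (hS : forall i, premodel (S i)).
Hypothesis hP : admissible U P.

Local Notation Q := {x : forall i, S i | P x}.

(** One construction serves twice: with all sections and an ultrafilter it is an ultraproduct, with
    coherent sections and the filter of tails a direct limit. Equations transfer pointwise; inverses
    need [admV] and [adm_dec]. The last two conclusions transfer weak embeddings and first-row
    partners given factor by factor. *)
Lemma reduced_product : exists (T : structure n) (pi : Q -> T),
  [/\ premodel T, forall t, exists x, pi x = t,
      forall (M : structure n) (g : M -> Q),
        (forall i, weak_embedding (fun a => sval (g a) i)) ->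
        weak_embedding (fun a => pi (g a)) &
      forall (k : 'I_n) (x y : Q),
        U [set i | s_F (sval y i) /\
          s_mul (s_unit (S i) k k) (s_add (sval x i) (s_opp (sval y i))) =
          s_zero (S i)] ->
        s_F (pi y) /\
        s_mul (s_unit T k k) (s_add (pi x) (s_opp (pi y))) = s_zero T].
Proof.
pose E (x y : Q) := U [set i | sval x i = sval y i].
have [T [pi [repr [reprK piE]]]] : exists (T : Type) (pi : Q -> T) (repr : T -> Q),
    cancel repr pi /\ forall x y, pi x = pi y <-> E x y.
  apply: quotient_exists.
  - by move=> x; apply: filterE.
  - by move=> x y; apply: filterS => i /= ->.
  - by move=> x y z; apply: filterS2 => i /= -> ->.
pose q0 : Q := exist P _ (adm0 hP).
pose q1 : Q := exist P _ (adm1 hP).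
pose qD (x y : Q) : Q := exist P _ (admD hP (svalP x) (svalP y)).
pose qN (x : Q) : Q := exist P _ (admN hP (svalP x)).
pose qM (x y : Q) : Q := exist P _ (admM hP (svalP x) (svalP y)).
pose qe k l : Q := exist P _ (adm_unit hP k l).
(* Operations and F are computed on representatives; [piD], [piN], [piM] and [piF] show that the
   choice is immaterial. *)
pose TS := @Structure n T (pi q0) (pi q1)
  (fun s t => pi (qD (repr s) (repr t))) (fun s => pi (qN (repr s)))
  (fun s t => pi (qM (repr s) (repr t)))
  (fun s => U [set i | s_F (sval (repr s) i)]) (fun k l => pi (qe k l)).
have E_repr x : U [set i | sval (repr (pi x)) i = sval x i].
  by apply/piE; rewrite reprK.
have piD x y : @s_add n TS (pi x) (pi y) = pi (qD x y).
  apply/piE; apply: filterS2 (E_repr x) (E_repr y) => i /=.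
  by move=> -> ->.
have piN x : @s_opp n TS (pi x) = pi (qN x).
  by apply/piE; apply: filterS (E_repr x) => i /= ->.
have piM x y : @s_mul n TS (pi x) (pi y) = pi (qM x y).
  apply/piE; apply: filterS2 (E_repr x) (E_repr y) => i /=.
  by move=> -> ->.
have piF x : @s_F n TS (pi x) <-> U [set i | s_F (sval x i)].
  by split; apply: filterS2 (E_repr x) => i /= ->.
have pi_surj t : exists x, pi x = t by exists (repr t).
(* A nonzero class only says that the zero set of x is not in U; [adm_dec] turns this into being
   nonzero on a set in U. *)
have pi_neq0 x : pi x <> pi q0 -> U [set i | sval x i <> s_zero (S i)].
  by move=> x0; case: (adm_dec hP (svalP x)) => // ?; case: x0; apply/piE.
exists TS, pi; split=> //; last first.
- move=> k x y hxy; split; first by apply/piF; apply: filterS hxy => i [].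
  by rewrite piN piD (piM (qe k k)); apply/piE; apply: filterS hxy => i [].
- move=> M g hg; split=> [a b|||a b|a|a b|a Fa|k l].
  + by move=> /piE/filter_ex[i]; apply: (wemb_inj (hg i)).
  + by apply/piE/filterE => i; apply: (wemb0 (hg i)).
  + by apply/piE/filterE => i; apply: (wemb1 (hg i)).
  + by rewrite piD; apply/piE/filterE => i; apply: (wembD (hg i)).
  + by rewrite piN; apply/piE/filterE => i; apply: (wembN (hg i)).
  + by rewrite piM; apply/piE/filterE => i; apply: (wembM (hg i)).
  + by apply/piF/filterE => i; apply: (wembF (hg i)).
  + by apply/piE/filterE => i; apply: (wemb_unit (hg i)).
(* This is used with C the centralizer and with C = F. Inverses are chosen factor by factor, with
   value 0 where none exists; [admV] puts the resulting section in P. *)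
have quot_inv (C : forall i, S i -> Prop) (x : Q) :
    (forall i u, C i u -> u <> s_zero (S i) -> exists v,
      [/\ C i v, s_mul u v = s_one (S i) & s_mul v u = s_one (S i)]) ->
    U [set i | C i (sval x i)] -> pi x <> pi q0 ->
  exists y : Q, [/\ U [set i | C i (sval y i)],
      pi (qM x y) = pi q1 & pi (qM y x) = pi q1].
  move=> hC Cx /pi_neq0 x0.
  pose inv_at i v := [/\ C i v, s_mul (sval x i) v = s_one (S i)
    & s_mul v (sval x i) = s_one (S i)].
  pose v i := if pselect (exists v, inv_at i v) is left h
    then sval (cid h) else s_zero (S i).
  have hv : U [set i | inv_at i (v i)].
    apply: filterS2 Cx x0 => i /= Cxi xi0; rewrite /v.
    by case: pselect => [h|[]]; [case: cid|apply: hC].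
  have Pv : P v by apply: (admV hP (svalP x)); apply: filterS hv => i [].
  exists (exist P v Pv); split; first by apply: filterS hv => i [].
  - by apply/piE; apply: filterS hv => i [].
  - by apply/piE; apply: filterS hv => i [].
split.
- move=> s t u; have [x <-] := pi_surj s; have [y <-] := pi_surj t.
  have [z <-] := pi_surj u; rewrite !piD; apply/piE/filterE => i /=.
  exact: pm_addA.
- move=> s t; have [x <-] := pi_surj s; have [y <-] := pi_surj t.
  by rewrite !piD; apply/piE/filterE => i /=; apply: pm_addC.
- move=> s; have [x <-] := pi_surj s.
  by rewrite !piD; apply/piE/filterE => i /=; apply: pm_add0.
- move=> s; have [x <-] := pi_surj s.
  by rewrite piN piD; apply/piE/filterE => i /=; apply: pm_addN.
- move=> s t u; have [x <-] := pi_surj s; have [y <-] := pi_surj t.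
  have [z <-] := pi_surj u; rewrite !piM; apply/piE/filterE => i /=.
  exact: pm_mulA.
- move=> s; have [x <-] := pi_surj s.
  by rewrite !piM; apply/piE/filterE => i /=; apply: pm_mul1l.
- move=> s; have [x <-] := pi_surj s.
  by rewrite !piM; apply/piE/filterE => i /=; apply: pm_mul1r.
- move=> s t u; have [x <-] := pi_surj s; have [y <-] := pi_surj t.
  have [z <-] := pi_surj u; rewrite !(piM, piD); apply/piE/filterE => i /=.
  exact: pm_mulDl.
- move=> s t u; have [x <-] := pi_surj s; have [y <-] := pi_surj t.
  have [z <-] := pi_surj u; rewrite !(piM, piD); apply/piE/filterE => i /=.
  exact: pm_mulDr.
- transitivity (pi (\big[qD/q0]_(k < n) qe k k)).
    by apply/esym/big_morph => // x y; rewrite piD.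
  apply/piE/filterE => i /=; rewrite -(pm_unit_sum (hS i)).
  exact: (big_morph (fun x : Q => sval x i)).
- move=> j k l m; rewrite (piM (qe j k) (qe l m)); case: ifP => jk;
  apply/piE/filterE => i /=;
  by rewrite (pm_unit_mul (hS i)) jk.
- move=> s; have [x <-] := pi_surj s => x0 xc.
  pose C i (u : S i) := forall k l,
    s_mul u (s_unit (S i) k l) = s_mul (s_unit (S i) k l) u.
  have [|||y [Cy xy yx]] := @quot_inv C x.
  + by move=> i u Cu u0; apply: (pm_centralizer (hS i)).
  (* Centrality consists of finitely many equations, so the filter commutes with the quantifiers
     over k and l. *)
  + apply: filter_forall => k; apply: filter_forall => l.
    apply/(@piE (qM x (qe k l)) (qM (qe k l) x)).
    by rewrite -!piM; apply: xc.
  + exact: x0.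
  exists (pi y); split; rewrite ?piM //.
  move=> k l; rewrite !piM; apply/piE; apply: filterS Cy => i.
  exact.
- by apply/piF/filterE => i; apply: pm_F1.
- move=> s t; have [x <-] := pi_surj s; have [y <-] := pi_surj t.
  move=> /piF Fx /piF Fy; rewrite piN piD; apply/piF.
  by apply: filterS2 Fx Fy => i; apply: pm_FB.
- move=> s t; have [x <-] := pi_surj s; have [y <-] := pi_surj t.
  move=> /piF Fx /piF Fy; rewrite piM; apply/piF.
  by apply: filterS2 Fx Fy => i; apply: pm_FM.
- move=> /piE /filter_ex [i] /=; exact: (pm_neq (hS i)).
- move=> s; have [x <-] := pi_surj s => /piF Fx x0.
  have [i u Fu u0|//|//|y [Fy xy yx]] := @quot_inv (fun i => @s_F n (S i)) x.
    exact: (pm_FV (hS i)).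
  by exists (pi y); split; rewrite ?piM //; apply/piF.
Qed.

End ReducedProduct.

(** * Attaining first rows *)

Section FirstRow.

Variables (n : nat) (hn : (0 < n)%N).
Hypothesis hA : conjectureA n 1 n.

(** For a = 1 and b = n the upper right block is the whole first row. Agreement of all its corners
    gives the equation by summing over the e_ll. *)
Lemma F_meets_first_row_extension (S : structure n) (x : S) :
  premodel S -> exists (S' : structure n) (f : S -> S'),
    [/\ premodel S', weak_embedding f & F_meets_first_row (f x)].
Proof.
move=> hS.
have [S' [f [hS' hf [y [Fy xy]]]]] :=
  conjectureA_premodel x hA (add1n n) isT hn hS.
exists S', f; split=> // i i0; exists y; split=> //.
pose R := ring_of hS'.
change ((s_unit S' i i : R) * ((f x : R) - (y : R)) = 0).
rewrite -[LHS]mulr1 -(sum_unit hS') mulr_sumr big1 // => l _.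
rewrite mulrBr mulrBl; apply/eqP; rewrite subr_eq0; apply/eqP.
by apply/esym; apply: xy; rewrite ?i0 // subnn.
Qed.

(** Elements are treated one after another, since a first-row partner survives further weak
    embeddings. The list is over [ring_of hS] because membership needs an equality test. *)
Lemma F_meets_first_rows_extension (S : structure n) (hS : premodel S)
    (s : seq (ring_of hS)) :
  exists (S' : structure n) (f : S -> S'),
    [/\ premodel S', weak_embedding f
      & forall x, x \in s -> F_meets_first_row (f x)].
Proof.
elim: s => [|x s [S' [f [hS' hf hs]]]].
  by exists S, id; split=> //; apply: wemb_id.
have [S'' [g [hS'' hg hx]]] := F_meets_first_row_extension (f x) hS'.
exists S'', (g \o f); split=> //; first exact: wemb_comp.
move=> y; rewrite inE => /predU1P[->//|/hs hy].
exact: (F_meets_first_row_wemb hg hy).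
Qed.

(* An ultraproduct, over the finite sets s of elements of S, of extensions
   taking care of the elements of s. *)
Lemma all_first_rows_extension (S : structure n) :
  premodel S -> exists (S' : structure n) (f : S -> S'),
    [/\ premodel S', weak_embedding f & forall x, F_meets_first_row (f x)].
Proof.
move=> hS; pose I := seq (ring_of hS).
have ext (s : I) : exists S' : {S' : structure n & S -> S'},
    [/\ premodel (projT1 S'), weak_embedding (projT2 S')
      & forall x, x \in s -> F_meets_first_row (projT2 S' x)].
  by have [S' [f hf]] := F_meets_first_rows_extension s; exists (existT _ S' f).
have {ext} [ext hext] := choice ext.
pose T s := projT1 (ext s); pose f s : S -> T s := projT2 (ext s).
have hT s : premodel (T s) by case: (hext s).
have hf s : weak_embedding (f s) by case: (hext s).
(* The cones of lists containing a given list form a filter base: concatenation handles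
   intersections. U is an ultrafilter refining V. *)
pose V : set_system I :=
  filter_from [set: I] (fun s => [set t : I | {subset s <= t}]).
have FV : ProperFilter V.
  apply: filter_from_proper; last by move=> s _; exists s.
  apply: filter_fromT_filter; first by exists [::].
  move=> s t; exists (s ++ t) => u st; split=> x xs; apply: st;
  by rewrite mem_cat xs ?orbT.
have [U [UU VU]] := ultraFilterLemma FV.
have FU : ProperFilter U := @ultra_proper _ _ UU.
have adm : admissible U (fun _ : forall s, T s => True).
  by split=> // x _; apply: in_ultra_setVsetC.
have [T' [pi [hT' _ pi_wemb pi_row]]] :=
  reduced_product FU hT adm.
pose g (x : S) := pi (exist _ (fun s => f s x) Logic.I).
exists T', g; split=> //.
  exact: (@pi_wemb S (fun x => exist _ (fun s => f s x) Logic.I)).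
move=> x i i0.
pose row_ok s y := s_F y /\
  s_mul (s_unit (T s) i i) (s_add (f s x) (s_opp y)) = s_zero (T s).
(* A partner of x exists at every s containing x, a set of indices in V; elsewhere the default 0 may
   occur. *)
pose y s := if pselect (exists y, row_ok s y) is left h
  then sval (cid h) else s_zero (T s).
have hy : U [set s | row_ok s (y s)].
  apply: VU; exists [:: (x : ring_of hS)] => // s xs; rewrite /= /y.
  case: pselect => [h|[]]; first by case: cid.
  have [_ _ hx] := hext s; apply: hx => //.
  by apply: xs; apply: mem_head.
exists (pi (exist _ y Logic.I)).
exact: (@pi_row i (exist _ (fun s => f s x) Logic.I) (exist _ y Logic.I)).
Qed.

End FirstRow.

(** * Direct limits of chains *)

Lemma s_mul_inv_uniq (n : nat) (T : structure n) (x y z : T) : premodel T ->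
  s_mul y x = s_one T -> s_mul x z = s_one T -> y = z.
Proof.
by move=> hT yx xz; rewrite -[y](pm_mul1r hT) -xz (pm_mulA hT) yx (pm_mul1l hT).
Qed.

Section DirectLimit.

Variables (n : nat) (S : nat -> structure n) (f : forall k, S k -> S k.+1).
Arguments f : clear implicits.
Hypotheses (hS : forall k, premodel (S k)) (hf : forall k, weak_embedding (f k)).

(** Below K the section is arbitrary; modulo the filter of tails, coherent sections are the elements
    of the direct limit. *)
Definition coherent_from (K : nat) (x : forall k, S k) : Prop :=
  forall k, (K <= k)%N -> x k.+1 = f k (x k).

Definition coherent (x : forall k, S k) : Prop := exists K, coherent_from K x.

Lemma coherent_from_max K L x y : coherent_from K x -> coherent_from L y ->
  exists M, coherent_from M x /\ coherent_from M y.
Proof.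
move=> hx hy; exists (maxn K L).
by split=> k; rewrite geq_max => /andP[Kk Lk]; [apply: hx|apply: hy].
Qed.

(** An inverse y of x is coherent because [y k.+1] and [f k (y k)] both invert [x k.+1]. Once x
    vanishes at a stage from K on it stays zero; otherwise it is nonzero from K on. *)
Lemma coherent_admissible : admissible \oo coherent.
Proof.
split.
- by exists 0%N => k _; rewrite (wemb0 (hf k)).
- by exists 0%N => k _; rewrite (wemb1 (hf k)).
- move=> x y [K hx] [L /(coherent_from_max hx) [M [{}hx hy]]].
  by exists M => k Mk; rewrite hx // hy // (wembD (hf k)).
- by move=> x [K hx]; exists K => k Kk; rewrite hx // (wembN (hf k)).
- move=> x y [K hx] [L /(coherent_from_max hx) [M [{}hx hy]]].
  by exists M => k Mk; rewrite hx // hy // (wembM (hf k)).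
- by move=> i j; exists 0%N => k _; rewrite (wemb_unit (hf k)).
- move=> x y [K hx] [L _ hxy]; exists (maxn K L) => k.
  rewrite geq_max => /andP[Kk Lk].
  have [_ yx] := hxy k.+1 (leqW Lk); have [xy _] := hxy k Lk.
  apply: (s_mul_inv_uniq (hS k.+1) yx).
  by rewrite hx // -(wembM (hf k)) xy (wemb1 (hf k)).
- move=> x [K hx].
  have [x0|x0] := pselect (exists2 k, (K <= k)%N & x k = s_zero (S k)).
    case: x0 => k Kk xk0; left; exists k => // m /= /subnK <-.
    elim: (m - k)%N => // d IHd.
    by rewrite addSn hx ?IHd ?(wemb0 (hf _)) // (leq_trans Kk) ?leq_addl.
  by right; exists K => // m /= Km xm0; apply: x0; exists m.
Qed.

End DirectLimit.

(** From stage 0 one iterates f; otherwise induction on K shifts the chain by one, and stage 0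
    receives a dummy 0. *)
Lemma coherent_extension (n : nat) (S : nat -> structure n)
    (f : forall k, S k -> S k.+1) (K : nat) (a : S K) :
  exists x : forall k, S k, x K = a /\ coherent_from f K x.
Proof.
elim: K S f a => [|K IHK] S f a.
  by exists (fun k => nat_rect _ a (fun i y => f i y) k).
have [x [xK hx]] := IHK (fun k => S k.+1) (fun k => f k.+1) a.
exists (fun k => if k is k'.+1 then x k' else s_zero (S 0%N)); split=> //.
by case=> // k; apply: hx.
Qed.

Lemma one_tight_direct_limit (n : nat) (S : nat -> structure n)
    (f : forall k, S k -> S k.+1) :
  (forall k, premodel (S k)) -> (forall k, weak_embedding (f k)) ->
  (forall k x, F_meets_first_row (f k x)) ->
  exists (T : structure n) (g : S 0%N -> T),
    [/\ premodel T, weak_embedding g & one_tight T].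
Proof.
move=> hS hf hrow.
have [T [pi [hT pi_surj pi_wemb pi_row]]] :=
  reduced_product eventually_filter hS (coherent_admissible hS hf).
pose lift (a : S 0%N) k : S k := nat_rect _ a (fun i y => f i y) k.
have lift_coherent a : coherent f (lift a) by exists 0%N.
have lift_wemb k : weak_embedding (fun a => lift a k).
  elim: k => [|k IHk]; first exact: wemb_id.
  exact: (wemb_comp IHk (hf k)).
pose g (a : S 0%N) := pi (exist _ (lift a) (lift_coherent a)).
exists T, g; split=> //.
  exact: (@pi_wemb (S 0%N) (fun a => exist _ (lift a) (lift_coherent a))).
move=> t i i0; have [[x Px] <-] := pi_surj t; have [K hx] := Px.
(* The partner [y0] of [x K] lives one stage later, in [S K.+1]; its images are partners of x at all
   subsequent stages. *)
have [y0 [Fy0 xy0]] := hrow K (x K) i i0.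
have [y [yK hy]] := coherent_extension f y0.
have Py : coherent f y by exists K.+1.
have y_ok k : (K < k)%N -> s_F (y k) /\
    s_mul (s_unit (S k) i i) (s_add (x k) (s_opp (y k))) = s_zero (S k).
  move=> /subnK <-; elim: (k - K.+1)%N => [|d [IHF IHd]].
    by rewrite yK hx.
  have Kd : (K <= d + K.+1)%N by rewrite addnS leqW ?leq_addl.
  rewrite addSn hy ?leq_addl // hx //; split; first exact: (wembF (hf _)).
  rewrite -(wembN (hf _)) -(wembD (hf _)) -(wemb_unit (hf _)).
  by rewrite -(wembM (hf _)) IHd (wemb0 (hf _)).
exists (pi (exist _ y Py)); apply: (pi_row i (exist _ x Px) (exist _ y Py)).
by exists K.+1.
Qed.

(** * Extending premodels to models, and transfer back *)

Lemma one_tight_extension (n : nat) (S : structure n) :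
  (0 < n)%N -> conjectureA n 1 n -> premodel S ->
  exists (T : structure n) (g : S -> T),
    [/\ premodel T, weak_embedding g & one_tight T].
Proof.
move=> hn hA hS.
(* Bundling the premodel proof with the structure lets the extension step be iterated. *)
pose X := {S : structure n | premodel S}.
have ext (A : X) : exists Bf : {B : X & sval A -> sval B},
    weak_embedding (projT2 Bf) /\ forall x, F_meets_first_row (projT2 Bf x).
  have [B [f [hB hf hrow]]] := all_first_rows_extension hn hA (svalP A).
  by exists (existT (fun B : X => sval A -> sval B) (exist _ B hB) f).
pose step A := projT1 (cid (ext A)).
have hstep A : weak_embedding (projT2 (step A)) /\
  forall x, F_meets_first_row (projT2 (step A) x) := projT2 (cid (ext A)).
pose A k := iter k (fun A => projT1 (step A)) (exist _ S hS : X).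
apply: (@one_tight_direct_limit n (fun k => sval (A k))
  (fun k => projT2 (step (A k)))).
- by move=> k; apply: svalP.
- by move=> k; case: (hstep (A k)).
- by move=> k; case: (hstep (A k)).
Qed.

(* If f x lies in F, subtract from x an element of F with the same first row:
   the image of the difference lies in the division ring F of N and has a zero
   first row, so it is not invertible, hence zero. *)
Lemma one_tight_embedding (n : nat) (M N : structure n) (f : M -> N) :
  (0 < n)%N -> premodel M -> one_tight M -> premodel N -> weak_embedding f ->
  embedding f.
Proof.
move=> hn hM tM hN hf; case: (hf) => *; split=> // x.
split=> [Ffx|]; last exact: wembF.
have [y [Fy xy]] := tM x (Ordinal hn) erefl.
pose R := ring_of hN; pose e : R := s_unit N (Ordinal hn) (Ordinal hn).
have exy : e * ((f x : R) - (f y : R)) = 0.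
  have := congr1 f xy.
  by rewrite (wembM hf) (wembD hf) (wembN hf) (wemb_unit hf) (wemb0 hf).
suff fxy : (f x : R) - (f y : R) = 0.
  suff -> : x = y by [].
  by apply: (wemb_inj hf); apply: (@subr0_eq R).
apply: contrapT => xy0.
have [z [_ xyz _]] := pm_FV hN (pm_FB hN Ffx (wembF hf Fy)) xy0.
have e0 : e = 0.
  rewrite -[e]mulr1 -[X in _ * X]/(s_one N) -xyz.
  by rewrite -[LHS]/(e * (((f x : R) - (f y : R)) * (z : R))) mulrA exy mul0r.
(* Since e_ii = e_i0 e_00 e_0i, the vanishing of e_00 kills every e_ii and hence their sum 1. *)
apply: (pm_neq hN); rewrite -(pm_unit_sum hN).
change (\sum_i (s_unit N i i : R) = 0); apply: big1 => i _.
have := mul_unit hN i (Ordinal hn) (Ordinal hn) i; rewrite eqxx => <-.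
have := mul_unit hN (Ordinal hn) (Ordinal hn) (Ordinal hn) i; rewrite eqxx => <-.
by rewrite -/e e0 mul0r mulr0.
Qed.

(** The parameter x encodes a whole block, so one parameter suffices; it is named [Some x] under the
    quantifier, which binds [None]. *)
Definition block_formula (n a b : nat) (M : structure n) (x : M) :
    formula n M :=
  Ex (And (InF (Var _ None))
    (\big[@And n _/Tru]_(kl : 'I_n * 'I_n | (kl.1 < a)%N && (n - b <= kl.2)%N)
      (MUnit kl.1 kl.1 * Var _ None * MUnit kl.2 kl.2 ==
       MUnit kl.1 kl.1 * Var _ (Some x) * MUnit kl.2 kl.2)%fo)).

Lemma existential_block_formula (n a b : nat) (M : structure n) (x : M) :
  existential (block_formula a b x).
Proof. by split=> //; apply: quantifier_free_big_And. Qed.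

Lemma sat_block_formula (n a b : nat) (M N : structure n) (f : M -> N) (x : M) :
  sat f (block_formula a b x) <->
  exists y, s_F y /\ same_upper_right_block a b y (f x).
Proof.
split=> -[y [Fy xy]]; exists y; split=> //.
  move=> k l ka bl; have /sat_big_And/(_ (k, l)) /= := xy.
  by apply; rewrite ka.
by apply/sat_big_And => -[k l] /= /andP[ka bl]; apply: xy.
Qed.

Theorem proposition4p1
  (hA : forall n a b : nat, (1 < n)%N -> (0 < a)%N -> (0 < b)%N ->
        (a + b = n.+1)%N -> conjectureA n a b)
  (n : nat) (hn : (1 < n)%N)
  (M : structure n) (hM : existentially_closed (@T1 n) M) :
  is_tight_embedding M.
Proof.
have n0 : (0 < n)%N := ltnW hn.
have [/model_T1P [pM tM] ecM] := hM.
have [F [G [phi [dF dG phi_inj M_iso]]]] := premodel_isomorphic pM.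
exists F, G, phi; split=> // a /andP[a0 _] b b0 hab g.
have [h [hh [h' hK h'K]]] := M_iso.
have hA1n : conjectureA n 1 n by apply: hA => //; rewrite add1n.
(* A full matrix with block g. Rows from a on are 0; to the left of the block, truncated subtraction
   repeats the first column of g, which is harmless. *)
pose A : 'M[G]_n := \matrix_(k, l)
  if (insub (k : nat), insub (l - (n - b))%N) is (Some i, Some j) then g i j else 0.
have [N [f [pN hf [y [Fy xy]]]]] :=
  conjectureA_premodel (h' A) (hA n a b hn a0 b0 hab) hab a0 b0 pM.
have [T [u [pT hu tT]]] := one_tight_extension n0 hA1n pN.
(* Existential closedness speaks of embeddings that reflect F; the 1-tightness of M upgrades the
   weak embedding. *)
have huf : embedding (u \o f) := one_tight_embedding n0 pM tM pT (wemb_comp hf hu).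
have /ecM ec : model (@T1 n) T by apply/model_T1P.
have /sat_block_formula [z [Fz zA]] : sat (@id M) (block_formula a b (h' A)).
  apply: ec huf _ (existential_block_formula _ _ _) _.
  apply/sat_block_formula; exists (u y); split; first exact: wembF.
  by move=> k l ka bl; rewrite -!(wemb_unit hu) -!(wembM hu) xy.
have /(emb_F hh) [z0 hz] := Fz.
exists z0 => i j k l ki lj; rewrite -hz.
have -> : g i j = A k l by rewrite mxE ki lj addKn !valK.
(* Writing A as [h (h' A)] reduces the claim to the image under h of the corner equation [zA] in
   M. *)
rewrite -[A]h'K; apply/delta_mx_corner_eq.
rewrite -[LHS]/(s_mul (s_mul (s_unit (embedding_structure phi) k k) _)
  (s_unit (embedding_structure phi) l l)).
have := congr1 h (zA k l _ _); rewrite !(emb_mul hh) !(emb_unit hh) /=.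
by apply; rewrite ?ki ?lj // leq_addr.
Qed.
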